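(* Let $T>0$, $R\ge 0$, and let $\xi\in C([0,T])$ be a real-valued continuous path. Let $\Theta:\mathbb{R}^2\to\mathbb{R}$ be uniformly continuous with $\Theta\ge 0$ everywhere and $\Theta(x,y)\ge 1$ whenever $\min\{x,y\}\ge R$. Let $u:[0,T]\times\mathbb{R}^2\to\mathbb{R}$ be the (Lions–Souganidis) viscosity solution of $$\partial_t u = \big(|\partial_x u| - |\partial_y u|\big)\,\dot\xi(t)\quad\text{on } (0,T)\times\mathbb{R}^2,\qquad u(0,x,y)=|x-y|+\Theta(x,y).$$ Then $$u(T,0,0)\;\ge\;\min\left\{\left(\sup_{(t_0,\dots,t_n)\in\mathcal{P}}\ \frac{\sum_{j=0}^{n-1}|\xi(t_{j+1})-\xi(t_j)|}{n}-\frac{R}{n}\right)_+,\ 1\right\}.$$ In particular, $u(T,0,0)>0$ whenever $V_{0,T}(\xi)>R$.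
   Context: $\mathcal{P}$ denotes the set of partitions $(t_0,\dots,t_n)$ of $[0,T]$ with $0=t_0\le t_1\le\dots\le t_n=T$ ($n\ge1$ arbitrary). The total variation is $V_{0,T}(\xi)=\sup_{(t_0,\dots,t_n)\in\mathcal{P}}\sum_{i=0}^{n-1}|\xi(t_{i+1})-\xi(t_i)|$. $(a)_+=\max\{a,0\}$. For $\xi\in C^1$, the equation is understood in the classical viscosity sense with $\dot\xi$ the derivative; for merely continuous $\xi$, the solution is defined (following Lions–Souganidis, valid since $H(p,q)=|p|-|q|$ is a difference of convex Lipschitz functions) as the unique function $u$ such that, for every sequence $\xi_k\in C^1([0,T])$ with $\xi_k\to\xi$ uniformly, the viscosity solutions $u_k$ of the equation driven by $\xi_k$ with the same initial datum converge locally uniformly to $u$. *)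

(* Defs.v *)
From Stdlib Require Import Reals Lra.
Open Scope R_scope.

Definition cont3 (f : R -> R -> R -> R) : Prop :=
  forall t x y eps, 0 < eps -> exists delta, 0 < delta /\
    forall s a b, Rabs (s - t) < delta -> Rabs (a - x) < delta -> Rabs (b - y) < delta ->
      Rabs (f s a b - f t x y) < eps.

Definition cont_strip (T : R) (f : R -> R -> R -> R) : Prop :=
  forall t x y eps, 0 <= t <= T -> 0 < eps -> exists delta, 0 < delta /\
    forall s a b, 0 <= s <= T ->
      Rabs (s - t) < delta -> Rabs (a - x) < delta -> Rabs (b - y) < delta ->
      Rabs (f s a b - f t x y) < eps.

Definition frechet3 (phi : R -> R -> R -> R) (t x y pt px py : R) : Prop :=
  forall eps, 0 < eps -> exists delta, 0 < delta /\
    forall s a b, Rabs (s - t) < delta -> Rabs (a - x) < delta -> Rabs (b - y) < delta ->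
      Rabs (phi s a b - phi t x y - pt * (s - t) - px * (a - x) - py * (b - y))
        <= eps * (Rabs (s - t) + Rabs (a - x) + Rabs (b - y)).

Definition C1_3 (phi Dt Dx Dy : R -> R -> R -> R) : Prop :=
  (forall t x y, frechet3 phi t x y (Dt t x y) (Dx t x y) (Dy t x y)) /\
  cont3 Dt /\ cont3 Dx /\ cont3 Dy.

Definition loc_max (T : R) (w : R -> R -> R -> R) (t x y : R) : Prop :=
  exists r, 0 < r /\ forall s a b, 0 < s < T ->
    Rabs (s - t) < r -> Rabs (a - x) < r -> Rabs (b - y) < r -> w s a b <= w t x y.
Definition loc_min (T : R) (w : R -> R -> R -> R) (t x y : R) : Prop :=
  exists r, 0 < r /\ forall s a b, 0 < s < T ->
    Rabs (s - t) < r -> Rabs (a - x) < r -> Rabs (b - y) < r -> w t x y <= w s a b.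

Definition visc_sol (T : R) (dxi : R -> R) (u0 : R -> R -> R) (v : R -> R -> R -> R) : Prop :=
  cont_strip T v /\ (forall x y, v 0 x y = u0 x y) /\
  forall phi Dt Dx Dy, C1_3 phi Dt Dx Dy -> forall t x y, 0 < t < T ->
    (loc_max T (fun s a b => v s a b - phi s a b) t x y ->
       Dt t x y <= (Rabs (Dx t x y) - Rabs (Dy t x y)) * dxi t) /\
    (loc_min T (fun s a b => v s a b - phi s a b) t x y ->
       Dt t x y >= (Rabs (Dx t x y) - Rabs (Dy t x y)) * dxi t).

(* xi is C^1 with derivative dxi (on all of R; any C^1([0,T]) path extends so). *)
Definition C1_path (xi dxi : R -> R) : Prop :=
  (forall t, derivable_pt_lim xi t (dxi t)) /\ continuity dxi.

Definition cont_path (T : R) (xi : R -> R) : Prop :=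
  forall t eps, 0 <= t <= T -> 0 < eps -> exists delta, 0 < delta /\
    forall s, 0 <= s <= T -> Rabs (s - t) < delta -> Rabs (xi s - xi t) < eps.

Definition unif_conv_path (T : R) (xik : nat -> R -> R) (xi : R -> R) : Prop :=
  forall eps, 0 < eps -> exists N, forall k t, (N <= k)%nat -> 0 <= t <= T ->
    Rabs (xik k t - xi t) < eps.

Definition loc_unif_conv (T : R) (uk : nat -> R -> R -> R -> R) (u : R -> R -> R -> R) : Prop :=
  forall M eps, 0 < eps -> exists N, forall k t x y, (N <= k)%nat -> 0 <= t <= T ->
    Rabs x <= M -> Rabs y <= M -> Rabs (uk k t x y - u t x y) < eps.

Definition LS_sol (T : R) (xi : R -> R) (u0 : R -> R -> R) (u : R -> R -> R -> R) : Prop :=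
  forall (xik dxik : nat -> R -> R) (uk : nat -> R -> R -> R -> R),
    (forall k, C1_path (xik k) (dxik k)) ->
    unif_conv_path T xik xi ->
    (forall k, visc_sol T (dxik k) u0 (uk k)) ->
    loc_unif_conv T uk u.

Definition unif_cont2 (f : R -> R -> R) : Prop :=
  forall eps, 0 < eps -> exists delta, 0 < delta /\
    forall x y a b, Rabs (a - x) < delta -> Rabs (b - y) < delta ->
      Rabs (f a b - f x y) < eps.

Definition is_partition (T : R) (n : nat) (tt : nat -> R) : Prop :=
  (1 <= n)%nat /\ tt 0%nat = 0 /\ tt n = T /\
  (forall j, (j < n)%nat -> tt j <= tt (S j)).

Definition var_sum (xi : R -> R) (n : nat) (tt : nat -> R) : R :=
  sum_f_R0 (fun j => Rabs (xi (tt (S j)) - xi (tt j))) (n - 1).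

Definition avg_set (T Rr : R) (xi : R -> R) : R -> Prop :=
  fun v => exists n tt, is_partition T n tt /\ v = var_sum xi n tt / INR n - Rr / INR n.

Definition tv_set (T : R) (xi : R -> R) : R -> Prop :=
  fun v => exists n tt, is_partition T n tt /\ v = var_sum xi n tt.

(* Main.v *)
Require Import Defs.
From Stdlib Require Import Reals Lra Lia.
From Coquelicot Require Import Coquelicot.
Open Scope R_scope.

(** For a Lipschitz path, a viscosity solution is the lower value of a differential game played
    backwards from time [t]: over [[s, t]] the maximizer displaces [x] by at most [up] and [y] by at
    most [down], then the minimizer displaces [x] by at most [down] and [y] by at most [up]; the
    payoff is the initial datum. As [up - down] is the increment of the path, the Hamiltonian is
    [(|p| - |q|) dxi]. Since displacements commute, committing first over a longer time step only
    hurts, which gives both dynamic programming inequalities and hence the viscosity property.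
    An explicit strategy of the maximizer along a partition bounds the value at the origin from
    below, and the bound passes to the limit along [C^1] Lipschitz approximations of the path. *)

(** * The game: displacement budgets and guaranteed payoffs *)

Definition lipschitz (C : R) (xi : R -> R) : Prop :=
  forall s t, s <= t -> Rabs (xi t - xi s) <= C * (t - s).

(** [up] and [down] are the increments over [[s, t]] of [(C t + xi)/2] and [(C t - xi)/2]. Both
    functions are nondecreasing when [xi] is [C]-Lipschitz, so their increments can serve as
    budgets. *)
Definition up (C : R) (xi : R -> R) (s t : R) : R := (C * (t - s) + (xi t - xi s)) / 2.
Definition down (C : R) (xi : R -> R) (s t : R) : R := (C * (t - s) - (xi t - xi s)) / 2.

(* The maximizer, moving first in each step, can secure a payoff of at least [c] from [(x, y)] at
   time [t]. The time steps may adapt to the opponent's moves: this makes [value_ge_step] immediate,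
   with no need of a common partition. *)
Inductive guarantees (C : R) (xi : R -> R) (f : R -> R -> R) : R -> R -> R -> R -> Prop :=
| guarantees_stop x y c : c <= f x y -> guarantees C xi f 0 x y c
| guarantees_step s t x y p q c :
    0 <= s <= t -> Rabs p <= up C xi s t -> Rabs q <= down C xi s t ->
    (forall p' q', Rabs p' <= down C xi s t -> Rabs q' <= up C xi s t ->
       guarantees C xi f s (x + p + p') (y + q + q') c) ->
    guarantees C xi f t x y c.

(** [real] sends an infinite supremum to 0; [value_is_lub] rules this out for Lipschitz [xi],
    uniformly continuous [f] and [0 <= t]. *)
Definition value (C : R) (xi : R -> R) (f : R -> R -> R) (t x y : R) : R :=
  real (Lub_Rbar (guarantees C xi f t x y)).

Lemma up_ge0 C xi s t : lipschitz C xi -> s <= t -> 0 <= up C xi s t.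
Proof.
  intros HL Hst. generalize (HL s t Hst) (Rle_abs (xi s - xi t)).
  rewrite (Rabs_minus_sym (xi s)). unfold up. lra.
Qed.

Lemma down_ge0 C xi s t : lipschitz C xi -> s <= t -> 0 <= down C xi s t.
Proof.
  intros HL Hst. generalize (HL s t Hst) (Rle_abs (xi t - xi s)). unfold down. lra.
Qed.

Lemma up_chasles C xi r s t : up C xi r t = up C xi s t + up C xi r s.
Proof. unfold up. field. Qed.

Lemma down_chasles C xi r s t : down C xi r t = down C xi s t + down C xi r s.
Proof. unfold down. field. Qed.

Lemma up_add_down C xi s t : up C xi s t + down C xi s t = C * (t - s).
Proof. unfold up, down. field. Qed.

Lemma up_sub_down C xi s t : up C xi s t - down C xi s t = xi t - xi s.
Proof. unfold up, down. field. Qed.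

(** Clamping [p] to [[-a, a]] leaves a remainder of size at most [b]. This shares out a move between
    two consecutive time intervals. *)
Lemma Rabs_split a b p : 0 <= a -> 0 <= b -> Rabs p <= a + b ->
  exists p1 p2, p = p1 + p2 /\ Rabs p1 <= a /\ Rabs p2 <= b.
Proof.
  intros Ha Hb Hp. apply Rabs_le_between in Hp.
  exists (Rmax (- a) (Rmin a p)), (p - Rmax (- a) (Rmin a p)).
  split; [ring|].
  unfold Rmax, Rmin; repeat destruct (Rle_dec _ _);
    split; apply Rabs_le_between; lra.
Qed.

Lemma Rabs_add_le p q a b : Rabs p <= a -> Rabs q <= b -> Rabs (p + q) <= a + b.
Proof. intros. generalize (Rabs_triang p q). lra. Qed.

Lemma guarantees_0 C xi f x y c : guarantees C xi f 0 x y c -> c <= f x y.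
Proof.
  intros H. remember 0 as t eqn:Et. induction H as [x y c H|s t x y p q c Hs Hp Hq _ IH]; [easy|].
  assert (s = 0) by lra. subst s t.
  assert (U : up C xi 0 0 = 0) by (unfold up; field).
  assert (D : down C xi 0 0 = 0) by (unfold down; field).
  rewrite U in *; rewrite D in *.
  assert (p = 0) by (apply Rabs_eq_0; generalize (Rabs_pos p); lra).
  assert (q = 0) by (apply Rabs_eq_0; generalize (Rabs_pos q); lra).
  subst. rewrite <- (Rplus_0_r x), <- (Rplus_0_r y), <- (Rplus_0_r (x + 0)), <- (Rplus_0_r (y + 0)).
  apply IH; rewrite ?Rabs_R0; lra.
Qed.

(* If the opponent announces the sum of his moves on [r, t] in advance, the player can still answer. *)
Lemma guarantees_back C xi f t x y c : lipschitz C xi -> guarantees C xi f t x y c ->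
  forall r, 0 <= r <= t -> forall p' q', Rabs p' <= down C xi r t -> Rabs q' <= up C xi r t ->
  exists p q, Rabs p <= up C xi r t /\ Rabs q <= down C xi r t /\
    guarantees C xi f r (x + p + p') (y + q + q') c.
Proof.
  intros HL H. induction H as [x y c H|s t x y p q c Hs Hp Hq H IH]; intros r Hr p' q' Hp' Hq'.
  - assert (r = 0) by lra. subst r.
    assert (U : up C xi 0 0 = 0) by (unfold up; field).
    assert (D : down C xi 0 0 = 0) by (unfold down; field).
    rewrite U in *; rewrite D in *.
    assert (p' = 0) by (apply Rabs_eq_0; generalize (Rabs_pos p'); lra).
    assert (q' = 0) by (apply Rabs_eq_0; generalize (Rabs_pos q'); lra).
    subst. exists 0, 0. rewrite !Rplus_0_r, Rabs_R0.
    repeat split; try lra. now constructor.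
  - destruct (Rle_lt_dec r s) as [Hrs|Hsr].
    (* The announced moves are shared between [[s, t]] and [[r, s]]; the induction hypothesis
       answers the second share. *)
    + rewrite (down_chasles C xi r s t) in Hp'. rewrite (up_chasles C xi r s t) in Hq'.
      apply Rabs_split in Hp'; try (apply down_ge0; easy).
      apply Rabs_split in Hq'; try (apply up_ge0; easy).
      destruct Hp' as (p1 & p2 & -> & Hp1 & Hp2). destruct Hq' as (q1 & q2 & -> & Hq1 & Hq2).
      destruct (IH p1 q1 Hp1 Hq1 r (conj (proj1 Hr) Hrs) p2 q2 Hp2 Hq2) as (p3 & q3 & Hp3 & Hq3 & G).
      exists (p + p3), (q + q3).
      rewrite (up_chasles C xi r s t), (down_chasles C xi r s t).
      repeat split; try now apply Rabs_add_le.
      replace (x + (p + p3) + (p1 + p2)) with (x + p + p1 + p3 + p2) by ring.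
      now replace (y + (q + q3) + (q1 + q2)) with (y + q + q1 + q3 + q2) by ring.
    (* The first step of the strategy straddles [r]: the player makes the share of his move that
       fits [[r, t]] and keeps the rest for [[s, r]]. The opponent's moves on both pieces add up to
       one admissible answer to the whole step. *)
    + rewrite (up_chasles C xi s r t) in Hp. rewrite (down_chasles C xi s r t) in Hq.
      apply Rabs_split in Hp; try (apply up_ge0; easy || lra).
      apply Rabs_split in Hq; try (apply down_ge0; easy || lra).
      destruct Hp as (p1 & p2 & -> & Hp1 & Hp2). destruct Hq as (q1 & q2 & -> & Hq1 & Hq2).
      exists p1, q1. repeat split; auto.
      apply guarantees_step with (s := s) (p := p2) (q := q2); auto; [lra|].
      intros p3 q3 Hp3 Hq3.
      replace (x + p1 + p' + p2 + p3) with (x + (p1 + p2) + (p' + p3)) by ring.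
      replace (y + q1 + q' + q2 + q3) with (y + (q1 + q2) + (q' + q3)) by ring.
      apply H; rewrite (down_chasles C xi s r t) || rewrite (up_chasles C xi s r t);
        now apply Rabs_add_le.
Qed.

(** The same strategy is replayed from the shifted position; only the final payoff changes, losing
    at most [e]. *)
Lemma guarantees_translate C xi f t x y c dx dy e :
  (forall a b, f a b <= f (a + dx) (b + dy) + e) ->
  guarantees C xi f t x y c -> guarantees C xi f t (x + dx) (y + dy) (c - e).
Proof.
  intros Hf H. induction H as [x y c H|s t x y p q c Hs Hp Hq _ IH].
  - constructor. generalize (Hf x y). lra.
  - apply guarantees_step with (s := s) (p := p) (q := q); auto.
    intros p' q' Hp' Hq'.
    replace (x + dx + p + p') with (x + p + p' + dx) by ring.
    replace (y + dy + q + q') with (y + q + q' + dy) by ring. auto.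
Qed.

Lemma guarantees_weaken C xi f t x y c c' :
  c' <= c -> guarantees C xi f t x y c -> guarantees C xi f t x y c'.
Proof.
  intros Hc H. rewrite <- (Rplus_0_r x), <- (Rplus_0_r y).
  replace c' with (c - (c - c')) by ring.
  apply guarantees_translate; auto.
  intros. rewrite !Rplus_0_r. lra.
Qed.

(** * Finiteness of the value and dynamic programming *)

(** A player who stays put in a single step down to time 0 secures [m]; an opponent who stays put
    caps the payoff by [K]. In both cases only one side moves, by at most [C * t] in each
    coordinate. *)
Lemma guarantees_min C xi f t x y m K : lipschitz C xi -> 0 <= t ->
  (forall p q, Rabs p <= C * t -> Rabs q <= C * t -> m <= f (x + p) (y + q) <= K) ->
  guarantees C xi f t x y m /\ forall c, guarantees C xi f t x y c -> c <= K.
Proof.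
  intros HL Ht Hf.
  assert (HU : 0 <= up C xi 0 t) by now apply up_ge0.
  assert (HD : 0 <= down C xi 0 t) by now apply down_ge0.
  assert (HS := up_add_down C xi 0 t). rewrite Rminus_0_r in HS.
  split.
  - apply guarantees_step with (s := 0) (p := 0) (q := 0); rewrite ?Rabs_R0; try lra.
    intros p q Hp Hq. constructor. rewrite !Rplus_0_r. apply Hf; lra.
  - intros c H.
    destruct (guarantees_back C xi f t x y c HL H 0 (conj (Rle_refl 0) Ht) 0 0)
      as (p & q & Hp & Hq & G); rewrite ?Rabs_R0; auto.
    apply guarantees_0 in G. rewrite !Rplus_0_r in G.
    apply Rle_trans with (1 := G), Hf; lra.
Qed.

(** A displacement of size [M] is covered by a fixed number of hops of length at most [d / 2], each
    changing [f] by less than 1. *)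
Lemma unif_cont2_bounded f M : unif_cont2 f ->
  exists K, forall x y p q, Rabs p <= M -> Rabs q <= M -> Rabs (f (x + p) (y + q) - f x y) <= K.
Proof.
  intros Hf. destruct (Hf 1 Rlt_0_1) as (d & Hd & H).
  assert (St : forall n x y p q, Rabs p <= INR n * (d / 2) -> Rabs q <= INR n * (d / 2) ->
    Rabs (f (x + p) (y + q) - f x y) <= INR n).
  { induction n as [|n IH]; intros x y p q Hp Hq.
    - simpl in *. rewrite Rmult_0_l in Hp, Hq.
      assert (p = 0) by (apply Rabs_eq_0; generalize (Rabs_pos p); lra).
      assert (q = 0) by (apply Rabs_eq_0; generalize (Rabs_pos q); lra).
      subst. rewrite !Rplus_0_r, Rminus_diag, Rabs_R0. lra.
    - rewrite S_INR in *. rewrite Rmult_plus_distr_r, Rmult_1_l in Hp, Hq.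
      assert (Hn : 0 <= INR n * (d / 2)) by (apply Rmult_le_pos; [apply pos_INR | lra]).
      apply Rabs_split in Hp; try lra. apply Rabs_split in Hq; try lra.
      destruct Hp as (p1 & p2 & -> & Hp1 & Hp2). destruct Hq as (q1 & q2 & -> & Hq1 & Hq2).
      replace (f (x + (p1 + p2)) (y + (q1 + q2)) - f x y) with
        ((f (x + p1) (y + q1) - f x y) + (f (x + (p1 + p2)) (y + (q1 + q2)) - f (x + p1) (y + q1)))
        by ring.
      apply Rabs_add_le; auto. apply Rlt_le, H.
      + replace (x + (p1 + p2) - (x + p1)) with p2 by ring. lra.
      + replace (y + (q1 + q2) - (y + q1)) with q2 by ring. lra. }
  destruct (INR_unbounded (M / (d / 2))) as [n Hn].
  exists (INR n). intros x y p q Hp Hq.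
  assert (M <= INR n * (d / 2)).
  { replace M with (M / (d / 2) * (d / 2)) by (field; lra).
    apply Rmult_le_compat_r; lra. }
  apply St; lra.
Qed.

Lemma value_is_lub C xi f t x y : lipschitz C xi -> unif_cont2 f -> 0 <= t ->
  is_lub (guarantees C xi f t x y) (value C xi f t x y).
Proof.
  intros HL Hf Ht. destruct (unif_cont2_bounded f (C * t) Hf) as [K HK].
  destruct (guarantees_min C xi f t x y (f x y - K) (f x y + K) HL Ht) as [Hm HM].
  { intros p q Hp Hq. generalize (HK x y p q Hp Hq). rewrite Rabs_le_between. lra. }
  unfold value. destruct (Lub_Rbar_correct (guarantees C xi f t x y)) as [H1 H2].
  assert (B1 := H1 _ Hm).
  assert (B2 := H2 (Finite (f x y + K)) (fun c Hc => HM c Hc)).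
  destruct (Lub_Rbar _) as [l| |]; simpl in *; try easy.
  split; [exact H1|]. intros b Hb. apply (H2 (Finite b)). exact Hb.
Qed.

Lemma le_value C xi f t x y c : lipschitz C xi -> unif_cont2 f -> 0 <= t ->
  guarantees C xi f t x y c -> c <= value C xi f t x y.
Proof. intros HL Hf Ht. now apply value_is_lub. Qed.

Lemma value_le C xi f t x y b : lipschitz C xi -> unif_cont2 f -> 0 <= t ->
  (forall c, guarantees C xi f t x y c -> c <= b) -> value C xi f t x y <= b.
Proof. intros HL Hf Ht. now apply value_is_lub. Qed.

Lemma guarantees_lt_value C xi f t x y c : lipschitz C xi -> unif_cont2 f -> 0 <= t ->
  c < value C xi f t x y -> guarantees C xi f t x y c.
Proof.
  intros HL Hf Ht Hc. apply Classical_Prop.NNPP. intros N.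
  apply (Rlt_not_le _ _ Hc), value_le; auto.
  intros c' H'. apply Rnot_lt_le. intros Hlt. apply N.
  apply guarantees_weaken with (2 := H'). lra.
Qed.

Lemma value_0 C xi f x y : lipschitz C xi -> unif_cont2 f -> value C xi f 0 x y = f x y.
Proof.
  intros HL Hf. apply Rle_antisym.
  - apply value_le; auto; [lra|]. intros c. apply guarantees_0.
  - apply le_value; auto; [lra|]. constructor. lra.
Qed.

Lemma value_ge_step C xi f s t x y p q c : lipschitz C xi -> unif_cont2 f -> 0 <= s <= t ->
  Rabs p <= up C xi s t -> Rabs q <= down C xi s t ->
  (forall p' q', Rabs p' <= down C xi s t -> Rabs q' <= up C xi s t ->
     c <= value C xi f s (x + p + p') (y + q + q')) ->
  c <= value C xi f t x y.
Proof.
  intros HL Hf Hs Hp Hq H. apply Rnot_lt_le. intros Hlt.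
  (* The midpoint lies strictly below [c], hence is guaranteed after every answer, and strictly
     above the value at [(x, y)], which is absurd once it is guaranteed there. *)
  apply (Rlt_not_le ((c + value C xi f t x y) / 2) (value C xi f t x y)); [lra|].
  apply le_value; auto; [lra|].
  apply guarantees_step with (s := s) (p := p) (q := q); auto.
  intros p' q' Hp' Hq'. apply guarantees_lt_value; auto; [lra|].
  apply Rlt_le_trans with c; [lra|auto].
Qed.

(** The opponent's answer is fixed before the player moves; [guarantees_back] shows that any
    guaranteed payoff survives this. *)
Lemma value_le_step C xi f s t x y p' q' c : lipschitz C xi -> unif_cont2 f -> 0 <= s <= t ->
  Rabs p' <= down C xi s t -> Rabs q' <= up C xi s t ->
  (forall p q, Rabs p <= up C xi s t -> Rabs q <= down C xi s t ->
     value C xi f s (x + p + p') (y + q + q') <= c) ->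
  value C xi f t x y <= c.
Proof.
  intros HL Hf Hs Hp' Hq' H. apply value_le; auto; [lra|].
  intros c' G. destruct (guarantees_back _ _ _ _ _ _ _ HL G s Hs p' q' Hp' Hq')
    as (p & q & Hp & Hq & G').
  apply Rle_trans with (2 := H p q Hp Hq). apply le_value; auto; lra.
Qed.

(** * Continuity of the value in space and time *)

Lemma value_unif_cont C xi f eps : lipschitz C xi -> unif_cont2 f -> 0 < eps ->
  exists d, 0 < d /\ forall t x y p q, 0 <= t -> Rabs p < d -> Rabs q < d ->
    value C xi f t x y <= value C xi f t (x + p) (y + q) + eps.
Proof.
  intros HL Hf He. destruct (Hf eps He) as (d & Hd & H).
  exists d. split; auto. intros t x y p q Ht Hp Hq.
  apply value_le; auto. intros c G.
  apply guarantees_translate with (dx := p) (dy := q) (e := eps) in G.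
  - apply le_value in G; auto; lra.
  - intros a b.
    assert (Hab : Rabs (f (a + p) (b + q) - f a b) < eps).
    { apply H; ring_simplify (a + p - a) (b + q - b); auto. }
    apply Rabs_def2 in Hab. lra.
Qed.

Lemma lipschitz_ge0 C xi : lipschitz C xi -> 0 <= C.
Proof. intros HL. generalize (HL 0 1 Rle_0_1) (Rabs_pos (xi 1 - xi 0)). lra. Qed.

(** If one side stays put on [[s, t]], the other moves each coordinate by at most [C * (t - s)],
    which the spatial modulus absorbs. Each side staying put gives one inequality. *)
Lemma value_time_cont C xi f eps : lipschitz C xi -> unif_cont2 f -> 0 < eps ->
  exists d, 0 < d /\ forall s t x y, 0 <= s <= t -> t - s < d ->
    Rabs (value C xi f t x y - value C xi f s x y) <= eps.
Proof.
  intros HL Hf He. destruct (value_unif_cont C xi f eps HL Hf He) as (d & Hd & H).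
  assert (HC := lipschitz_ge0 C xi HL).
  (* [C + 1] rather than [C], which may be 0. *)
  exists (d / (C + 1)). split; [apply Rdiv_lt_0_compat; lra|].
  intros s t x y Hs Hst.
  assert (HS := up_add_down C xi s t).
  assert (HU : 0 <= up C xi s t) by (apply up_ge0; easy).
  assert (HD : 0 <= down C xi s t) by (apply down_ge0; easy).
  assert (Hd' : C * (t - s) < d).
  { apply Rmult_lt_compat_l with (r := C + 1) in Hst; [|lra].
    replace ((C + 1) * (d / (C + 1))) with d in Hst by (field; lra).
    nra. }
  apply Rabs_le_between. split.
  - enough (value C xi f s x y - eps <= value C xi f t x y) by lra.
    apply value_ge_step with (s := s) (p := 0) (q := 0); rewrite ?Rabs_R0; auto.
    intros p q Hp Hq. rewrite !Rplus_0_r.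
    generalize (H s x y p q (proj1 Hs)). lra.
  - enough (value C xi f t x y <= value C xi f s x y + eps) by lra.
    apply value_le_step with (s := s) (p' := 0) (q' := 0); rewrite ?Rabs_R0; auto.
    intros p q Hp Hq. rewrite !Rplus_0_r.
    generalize (H s (x + p) (y + q) (- p) (- q) (proj1 Hs)). rewrite !Rabs_Ropp.
    replace (x + p + - p) with x by ring. replace (y + q + - q) with y by ring. lra.
Qed.

Lemma value_cont_strip C xi f T : lipschitz C xi -> unif_cont2 f ->
  cont_strip T (value C xi f).
Proof.
  intros HL Hf t x y eps Ht He.
  destruct (value_unif_cont C xi f (eps / 4) HL Hf) as (d1 & Hd1 & H1); [lra|].
  destruct (value_time_cont C xi f (eps / 4) HL Hf) as (d2 & Hd2 & H2); [lra|].
  exists (Rmin d1 d2). split; [now apply Rmin_pos|].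
  intros s a b Hs Hst Ha Hb.
  assert (M1 := Rmin_l d1 d2). assert (M2 := Rmin_r d1 d2).
  assert (E : Rabs (value C xi f t x y - value C xi f s x y) <= eps / 4).
  { destruct (Rle_lt_dec s t).
    - apply H2; [lra|]. apply Rabs_def2 in Hst. lra.
    - rewrite Rabs_minus_sym. apply H2; [lra|]. apply Rabs_def2 in Hst. lra. }
  generalize (H1 s x y (a - x) (b - y) (proj1 Hs)).
  generalize (H1 s a b (x - a) (y - b) (proj1 Hs)).
  rewrite (Rabs_minus_sym x), (Rabs_minus_sym y).
  replace (x + (a - x)) with a by ring. replace (y + (b - y)) with b by ring.
  replace (a + (x - a)) with x by ring. replace (b + (y - b)) with y by ring.
  apply Rabs_le_between in E. intros A B.
  specialize (A ltac:(lra) ltac:(lra)). specialize (B ltac:(lra) ltac:(lra)).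
  apply Rabs_def1; lra.
Qed.

(** * The viscosity property of the value *)

(** One backward step [h] serves both expansions, that of the path and that of the test function,
    the latter uniformly over all displacements reachable in time [h]. *)
Lemma small_step_expansion C xi v phi t x y pt px py eps r : lipschitz C xi ->
  derivable_pt_lim xi t v -> frechet3 phi t x y pt px py -> 0 < t -> 0 < eps -> 0 < r ->
  exists h, 0 < h < t /\ h < r /\ C * h < r /\
    Rabs ((Rabs px - Rabs py) * (xi t - xi (t - h) - v * h)) <= eps * h /\
    forall a b, Rabs a <= C * h -> Rabs b <= C * h ->
      Rabs (phi (t - h) (x + a) (y + b) - phi t x y + pt * h - px * a - py * b) <= eps * h.
Proof.
  intros HL Hxi Hphi Ht He Hr. assert (HC := lipschitz_ge0 C xi HL).
  set (K := Rabs px + Rabs py + 1).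
  assert (HK : 0 < K) by (unfold K; generalize (Rabs_pos px) (Rabs_pos py); lra).
  destruct (Hxi (eps / K)) as [d1 Hd1]; [now apply Rdiv_lt_0_compat|].
  assert (He2 : 0 < eps / (1 + 2 * C)) by (apply Rdiv_lt_0_compat; lra).
  destruct (Hphi _ He2) as (d2 & Hd2 & H2).
  set (m := Rmin (Rmin t r) (Rmin d1 d2)).
  assert (Hm : 0 < m) by (apply Rmin_pos; apply Rmin_pos; auto; apply cond_pos).
  assert (m <= t /\ m <= r /\ m <= d1 /\ m <= d2) as (M1 & M2 & M3 & M4).
  { assert (A1 := Rmin_l (Rmin t r) (Rmin d1 d2)). assert (A2 := Rmin_r (Rmin t r) (Rmin d1 d2)).
    assert (A3 := Rmin_l t r). assert (A4 := Rmin_r t r).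
    assert (A5 := Rmin_l d1 d2). assert (A6 := Rmin_r d1 d2). fold m in A1, A2. lra. }
  (* Chosen so that [h + C * h = m / 2]: both [h] and [C * h] stay below every threshold. *)
  set (h := m / (2 * (C + 1))).
  assert (Hh : 0 < h) by (apply Rdiv_lt_0_compat; lra).
  assert (Hhm : 2 * h + 2 * (C * h) = m) by (unfold h; field; lra).
  assert (HCh : 0 <= C * h) by (apply Rmult_le_pos; lra).
  exists h. repeat split; try lra.
  - assert (Hd : Rabs (- h) = h) by (rewrite Rabs_Ropp; apply Rabs_pos_eq; lra).
    assert (D := Hd1 (- h) ltac:(apply Rlt_not_eq; lra) ltac:(lra)).
    replace ((xi (t + - h) - xi t) / - h - v) with ((xi t - xi (t - h) - v * h) / h) in D
      by (unfold Rminus; field; lra).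
    rewrite Rabs_div, (Rabs_pos_eq h) in D by lra.
    apply Rlt_div_l with (1 := Hh) in D.
    rewrite Rabs_mult. replace (eps * h) with (K * (eps / K * h)) by (field; lra).
    apply Rmult_le_compat; try apply Rabs_pos; [|lra].
    apply Rle_trans with (1 := Rabs_triang _ _). rewrite Rabs_Ropp, !Rabs_Rabsolu. unfold K. lra.
  - intros a b Ha Hb.
    assert (E : Rabs (t - h - t) = h) by (rewrite Rabs_left; lra).
    generalize (H2 (t - h) (x + a) (y + b)). rewrite E.
    replace (x + a - x) with a by ring. replace (y + b - y) with b by ring.
    intros D. specialize (D ltac:(lra) ltac:(lra) ltac:(lra)).
    replace (pt * (t - h - t)) with (- (pt * h)) in D by ring.
    replace (phi (t - h) (x + a) (y + b) - phi t x y + pt * h - px * a - py * b)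
      with (phi (t - h) (x + a) (y + b) - phi t x y - - (pt * h) - px * a - py * b) by ring.
    apply Rle_trans with (1 := D).
    replace (eps * h) with (eps / (1 + 2 * C) * (h + C * h + C * h)) by (field; lra).
    apply Rmult_le_compat_l; lra.
Qed.

Lemma extremal_move p A : 0 <= A -> exists a, Rabs a <= A /\ p * a = Rabs p * A.
Proof.
  intros HA. destruct (Rle_lt_dec 0 p).
  - exists A. rewrite (Rabs_pos_eq A), (Rabs_pos_eq p); auto; lra.
  - exists (- A). rewrite Rabs_Ropp, (Rabs_pos_eq A), (Rabs_left p); lra.
Qed.

Lemma mult_Rabs_le p a A : Rabs a <= A -> - (Rabs p * A) <= p * a <= Rabs p * A.
Proof.
  intros H. apply Rabs_le_between. rewrite Rabs_mult.
  apply Rmult_le_compat_l; auto. apply Rabs_pos.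
Qed.

(** Divide by [h], which may depend on [eps], and let [eps] tend to 0. Below, [K = 2] counts the two
    errors of [small_step_expansion]. *)
Lemma le_of_le_mult_eps a b K : 0 < K ->
  (forall eps, 0 < eps -> exists h, 0 < h /\ a * h <= b * h + K * (eps * h)) -> a <= b.
Proof.
  intros HK H. apply le_epsilon. intros e He.
  destruct (H (e / K)) as (h & Hh & Hab); [now apply Rdiv_lt_0_compat|].
  apply Rmult_le_reg_r with h; auto.
  replace ((b + e) * h) with (b * h + K * (e / K * h)) by (field; lra). exact Hab.
Qed.

(** The opponent moves against the gradient at full budget, contributing
    [- Rabs px * B - Rabs py * A]; the player gains at most [Rabs px * A + Rabs py * B]. The sum is
    [(Rabs px - Rabs py) * (A - B)], and [A - B] is the increment of [xi]. *)
Lemma value_subsolution C xi f T phi pt px py v t x y : lipschitz C xi -> unif_cont2 f ->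
  derivable_pt_lim xi t v -> frechet3 phi t x y pt px py -> 0 < t < T ->
  loc_max T (fun s a b => value C xi f s a b - phi s a b) t x y ->
  pt <= (Rabs px - Rabs py) * v.
Proof.
  intros HL Hf Hxi Hphi Ht (r & Hr & Hmax).
  apply le_of_le_mult_eps with 2; [lra|]. intros eps He.
  destruct (small_step_expansion C xi v phi t x y pt px py eps r HL Hxi Hphi)
    as (h & Hh & Hhr & HCh & Hdxi & Hexp); try easy.
  exists h. split; [easy|].
  assert (HS := up_add_down C xi (t - h) t). assert (HX := up_sub_down C xi (t - h) t).
  assert (HU : 0 <= up C xi (t - h) t) by (apply up_ge0; easy || lra).
  assert (HD : 0 <= down C xi (t - h) t) by (apply down_ge0; easy || lra).
  ring_simplify (t - (t - h)) in HS.
  set (A := up C xi (t - h) t) in *. set (B := down C xi (t - h) t) in *.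
  destruct (extremal_move px B HD) as (p' & Hp' & Ep').
  destruct (extremal_move py A HU) as (q' & Hq' & Eq').
  rewrite <- HX in Hdxi. apply Rabs_le_between in Hdxi.
  enough (value C xi f t x y <=
    value C xi f t x y - pt * h + (Rabs px - Rabs py) * (A - B) + eps * h) by lra.
  apply value_le_step with (s := t - h) (p' := - p') (q' := - q'); try rewrite Rabs_Ropp; auto; [lra|].
  intros p q Hp Hq. rewrite !Rplus_assoc. fold A in Hp. fold B in Hq.
  assert (Hpp : Rabs (p + - p') <= C * h).
  { rewrite <- HS. apply Rabs_add_le; auto. now rewrite Rabs_Ropp. }
  assert (Hqq : Rabs (q + - q') <= C * h).
  { rewrite <- HS, Rplus_comm. apply Rabs_add_le; auto. now rewrite Rabs_Ropp. }
  assert (L := Hmax (t - h) (x + (p + - p')) (y + (q + - q'))). cbv beta in L.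
  replace (x + (p + - p') - x) with (p + - p') in L by ring.
  replace (y + (q + - q') - y) with (q + - q') in L by ring.
  specialize (L ltac:(lra)).
  rewrite Rabs_left in L by lra.
  specialize (L ltac:(lra) ltac:(lra) ltac:(lra)).
  specialize (Hexp _ _ Hpp Hqq). apply Rabs_le_between in Hexp.
  generalize (mult_Rabs_le px p A Hp) (mult_Rabs_le py q B Hq). lra.
Qed.

(** Symmetric: the player moves along the gradient at full budget, and the opponent takes back at
    most [Rabs px * B + Rabs py * A]. *)
Lemma value_supersolution C xi f T phi pt px py v t x y : lipschitz C xi -> unif_cont2 f ->
  derivable_pt_lim xi t v -> frechet3 phi t x y pt px py -> 0 < t < T ->
  loc_min T (fun s a b => value C xi f s a b - phi s a b) t x y ->
  pt >= (Rabs px - Rabs py) * v.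
Proof.
  intros HL Hf Hxi Hphi Ht (r & Hr & Hmin). apply Rle_ge.
  apply le_of_le_mult_eps with 2; [lra|]. intros eps He.
  destruct (small_step_expansion C xi v phi t x y pt px py eps r HL Hxi Hphi)
    as (h & Hh & Hhr & HCh & Hdxi & Hexp); try easy.
  exists h. split; [easy|].
  assert (HS := up_add_down C xi (t - h) t). assert (HX := up_sub_down C xi (t - h) t).
  assert (HU : 0 <= up C xi (t - h) t) by (apply up_ge0; easy || lra).
  assert (HD : 0 <= down C xi (t - h) t) by (apply down_ge0; easy || lra).
  ring_simplify (t - (t - h)) in HS.
  set (A := up C xi (t - h) t) in *. set (B := down C xi (t - h) t) in *.
  destruct (extremal_move px A HU) as (p & Hp & Ep).
  destruct (extremal_move py B HD) as (q & Hq & Eq).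
  rewrite <- HX in Hdxi. apply Rabs_le_between in Hdxi.
  enough (value C xi f t x y - pt * h + (Rabs px - Rabs py) * (A - B) - eps * h
    <= value C xi f t x y) by lra.
  apply value_ge_step with (s := t - h) (p := p) (q := q); auto; [lra|].
  intros p' q' Hp' Hq'. rewrite !Rplus_assoc. fold B in Hp'. fold A in Hq'.
  assert (Hpp : Rabs (p + p') <= C * h) by (rewrite <- HS; now apply Rabs_add_le).
  assert (Hqq : Rabs (q + q') <= C * h) by (rewrite <- HS, Rplus_comm; now apply Rabs_add_le).
  assert (L := Hmin (t - h) (x + (p + p')) (y + (q + q'))). cbv beta in L.
  replace (x + (p + p') - x) with (p + p') in L by ring.
  replace (y + (q + q') - y) with (q + q') in L by ring.
  specialize (L ltac:(lra)).
  rewrite Rabs_left in L by lra.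
  specialize (L ltac:(lra) ltac:(lra) ltac:(lra)).
  specialize (Hexp _ _ Hpp Hqq). apply Rabs_le_between in Hexp.
  generalize (mult_Rabs_le px p' B Hp') (mult_Rabs_le py q' A Hq'). lra.
Qed.

Lemma value_visc_sol C xi dxi f T : lipschitz C xi -> unif_cont2 f ->
  (forall t, derivable_pt_lim xi t (dxi t)) -> visc_sol T dxi f (value C xi f).
Proof.
  intros HL Hf Hxi. split; [now apply value_cont_strip|].
  split; [intros; now apply value_0|].
  intros phi Dt Dx Dy (Hphi & _) t x y Ht. split; intros Hloc.
  - now apply (value_subsolution C xi f T phi _ _ _ (dxi t) t x y HL Hf (Hxi t) (Hphi t x y)).
  - now apply (value_supersolution C xi f T phi _ _ _ (dxi t) t x y HL Hf (Hxi t) (Hphi t x y)).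
Qed.

(** * The lower bound at the origin from an explicit strategy *)

(* The invariant: either the gap [Rabs (x - y)] is already [c], and the player preserves it by moving
   apart at full speed; or both coordinates exceed [m j], and the player pushes right the coordinate
   he controls in net, the other one lagging behind by less than [d] unless the gap reaches [d]. *)
Lemma guarantees_gap_or_push C xi f d n tt m : lipschitz C xi ->
  (forall x y, Rabs (x - y) <= f x y) ->
  (forall x y, m 0%nat <= x -> m 0%nat <= y -> d <= f x y) ->
  tt 0%nat = 0 -> (forall j, (j < n)%nat -> tt j <= tt (S j)) ->
  (forall j, (j < n)%nat -> m (S j) = m j - Rabs (xi (tt (S j)) - xi (tt j)) + d) ->
  forall j, (j <= n)%nat -> 0 <= tt j /\
    forall x y c, c <= Rabs (x - y) \/ (c <= d /\ m j <= x /\ m j <= y) ->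
      guarantees C xi f (tt j) x y c.
Proof.
  intros HL Hgap Hpush Ht0 Htt Hm. induction j as [|j IH]; intros Hj.
  - rewrite Ht0. split; [lra|]. intros x y c H. constructor.
    destruct H as [H|(H & Hx & Hy)].
    + now apply Rle_trans with (2 := Hgap x y).
    + now apply Rle_trans with (2 := Hpush x y Hx Hy).
  - destruct IH as [Htj IH]; [lia|].
    assert (Hs : tt j <= tt (S j)) by (apply Htt; lia).
    split; [lra|]. intros x y c H.
    assert (HX := up_sub_down C xi (tt j) (tt (S j))).
    assert (HU := up_ge0 C xi _ _ HL Hs). assert (HD := down_ge0 C xi _ _ HL Hs).
    specialize (Hm j ltac:(lia)). rewrite <- HX in Hm.
    set (A := up C xi (tt j) (tt (S j))) in *. set (B := down C xi (tt j) (tt (S j))) in *.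
    assert (Step : forall p q, Rabs p <= A -> Rabs q <= B ->
      (forall p' q', Rabs p' <= B -> Rabs q' <= A ->
        c <= Rabs (x + p + p' - (y + q + q')) \/
        (c <= d /\ m j <= x + p + p' /\ m j <= y + q + q')) ->
      guarantees C xi f (tt (S j)) x y c).
    { intros p q Hp Hq G. apply guarantees_step with (s := tt j) (p := p) (q := q); auto. }
    destruct H as [H|(H & Hx & Hy)].
    + destruct (Rle_lt_dec y x) as [Hxy|Hxy].
      * rewrite Rabs_pos_eq in H by lra.
        (* Moving apart widens the gap by [A + B], exactly the most that the opponent can close. *)
        apply (Step A (- B)); rewrite ?Rabs_Ropp; try (rewrite Rabs_pos_eq; lra).
        intros p' q' Hp' Hq'. left. apply Rabs_le_between in Hp', Hq'.
        rewrite Rabs_pos_eq; lra.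
      * rewrite Rabs_left in H by lra.
        apply (Step (- A) B); rewrite ?Rabs_Ropp; try (rewrite Rabs_pos_eq; lra).
        intros p' q' Hp' Hq'. left. apply Rabs_le_between in Hp', Hq'.
        rewrite Rabs_left1; lra.
    + apply (Step A B); try (rewrite Rabs_pos_eq; lra).
      intros p' q' Hp' Hq'.
      destruct (Rle_lt_dec d (Rabs (x + A + p' - (y + B + q')))) as [Hd|Hd]; [left; lra|right].
      apply Rabs_le_between in Hp', Hq'. apply Rabs_def2 in Hd.
      (* After the answer, [x] has lost at most [B - A] and [y] at most [A - B]. So one coordinate
         has gained at least [Rabs (A - B)], and the other is less than [d] away: both stay above
         [m (S j) + Rabs (A - B) - d = m j]. *)
      revert Hm. unfold Rabs. destruct (Rcase_abs _); lra.
Qed.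

Lemma value_lower_bound C xi f T Rr n tt : lipschitz C xi -> unif_cont2 f -> 0 < T ->
  (forall x y, Rabs (x - y) <= f x y) ->
  (forall x y, Rr <= x -> Rr <= y -> 1 <= f x y) ->
  is_partition T n tt ->
  Rmin (Rmax (var_sum xi n tt / INR n - Rr / INR n) 0) 1 <= value C xi f T 0 0.
Proof.
  intros HL Hf HT Hgap Hpush (Hn & Ht0 & HtT & Htt).
  assert (HN : 0 < INR n) by (apply lt_0_INR; lia).
  set (v := var_sum xi n tt / INR n - Rr / INR n).
  (* [d <= 1] lets [Theta] pay [d] at time 0; [d <= v] makes [m n <= 0], so that the origin
     satisfies the push invariant at time [T]. *)
  set (d := Rmin v 1).
  (* The solution of the recursion for the thresholds started at [Rr]. Index 0 is separate because
     [sum_f_R0] up to [i] has [i + 1] terms. *)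
  set (m := fun j => match j with
    | O => Rr
    | S i => Rr + INR j * d - sum_f_R0 (fun j => Rabs (xi (tt (S j)) - xi (tt j))) i end).
  destruct (guarantees_gap_or_push C xi f d n tt m) with (j := n) as [_ G]; auto.
  - intros x y Hx Hy. apply Rle_trans with 1; [apply Rmin_r | now apply Hpush].
  - intros [|j] Hj; unfold m; [simpl; lra|]. rewrite (S_INR (S j)). simpl sum_f_R0. lra.
  - rewrite HtT in G. apply le_value; auto; [lra|]. apply G.
    rewrite Rminus_0_r, Rabs_R0.
    destruct (Rle_lt_dec v 0) as [Hv|Hv].
    + left. apply Rle_trans with (1 := Rmin_l _ _). rewrite Rmax_right; lra.
    + right. rewrite Rmax_left by lra. split; [apply Rle_refl|].
      enough (m n <= 0) by easy.
      assert (E : m n = Rr + INR n * d - var_sum xi n tt).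
      { destruct n; [lia|]. unfold m, var_sum. now rewrite Nat.sub_succ, Nat.sub_0_r. }
      assert (INR n * d <= INR n * v) by (apply Rmult_le_compat_l; [lra|apply Rmin_l]).
      assert (INR n * v = var_sum xi n tt - Rr) by (unfold v; field; lra).
      lra.
Qed.

(** * Approximation of a continuous path by [C^1] Lipschitz paths *)

Lemma clamp_between T t : 0 <= T -> 0 <= Rmax 0 (Rmin T t) <= T.
Proof. intros HT. unfold Rmax, Rmin. repeat destruct (Rle_dec _ _); lra. Qed.

Lemma clamp_lipschitz T s t :
  Rabs (Rmax 0 (Rmin T s) - Rmax 0 (Rmin T t)) <= Rabs (s - t).
Proof.
  unfold Rmax, Rmin. repeat destruct (Rle_dec _ _); unfold Rabs;
    repeat destruct (Rcase_abs _); lra.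
Qed.

Lemma antiderivative_exists g : continuity g -> exists F, forall t, derivable_pt_lim F t (g t).
Proof.
  intros Hg. exists (fun t => RInt g 0 t). intros t. apply is_derive_Reals.
  apply is_derive_RInt with (a := 0).
  - apply filter_forall. intros b. apply (@RInt_correct R_CompleteNormedModule).
    apply (@ex_RInt_continuous R_CompleteNormedModule).
    intros z _. apply continuity_pt_filterlim, Hg.
  - apply continuity_pt_filterlim, Hg.
Qed.

(** The path is extended by constants to a bounded continuous [g], then averaged over
    [[t, t + h k]]. The derivative of the average is a difference quotient of [g], bounded by
    [2 * M / h k]; this constant may blow up with [k]. *)
Lemma C1_lipschitz_approximation T xi : 0 < T -> cont_path T xi ->
  exists (xik dxik : nat -> R -> R) (Ck : nat -> R),
    (forall k, C1_path (xik k) (dxik k)) /\ (forall k, lipschitz (Ck k) (xik k)) /\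
    unif_conv_path T xik xi.
Proof.
  intros HT Hxi. set (g := fun t => xi (Rmax 0 (Rmin T t))).
  assert (Hg : continuity g).
  { intros t e He. destruct (Hxi (Rmax 0 (Rmin T t)) e) as (d & Hd & H); [apply clamp_between; lra|easy|].
    exists d. split; auto. intros s [_ Hs]. simpl in *. unfold Rdist in *.
    apply H; [apply clamp_between; lra|].
    apply Rle_lt_trans with (2 := Hs), clamp_lipschitz. }
  assert (Hext : forall t, 0 <= t <= T -> g t = xi t).
  { intros t Ht. unfold g. now rewrite Rmin_right, Rmax_right. }
  assert (exists M, forall t, Rabs (g t) <= M) as [M HM].
  { destruct (continuity_ab_maj (fun t => Rabs (g t)) 0 T) as (z & Hz & _); [lra| |].
    - intros c _. apply (continuity_pt_comp g Rabs); [apply Hg|apply Rcontinuity_abs].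
    - exists (Rabs (g z)). intros t.
      assert (Ht := clamp_between T t (Rlt_le _ _ HT)).
      replace (g t) with (g (Rmax 0 (Rmin T t))) by now rewrite Hext.
      now apply Hz. }
  destruct (antiderivative_exists g Hg) as [F HF].
  set (h := fun k => / INR (S k)).
  assert (Hh : forall k, 0 < h k) by (intros; apply Rinv_0_lt_compat, lt_0_INR; lia).
  set (xik := fun k t => (F (t + h k) - F t) / h k).
  set (dxik := fun k t => (g (t + h k) - g t) / h k).
  assert (Hsh : forall k t, derivable_pt_lim (fun t => t + h k) t 1).
  { intros k t. rewrite <- (Rplus_0_r 1).
    apply (derivable_pt_lim_plus id (fun _ => h k));
      [apply derivable_pt_lim_id|apply derivable_pt_lim_const]. }
  assert (HD : forall k t, derivable_pt_lim (xik k) t (dxik k t)).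
  { intros k t. apply is_derive_Reals. unfold xik, dxik.
    apply is_derive_ext with (fun t => scal (/ h k) (minus (F (t + h k)) (F t))).
    { intros. unfold scal, minus, plus, opp; simpl. unfold mult; simpl. unfold Rdiv. ring. }
    replace ((g (t + h k) - g t) / h k) with (scal (/ h k) (minus (g (t + h k)) (g t)))
      by (unfold scal, minus, plus, opp; simpl; unfold mult; simpl; unfold Rdiv; ring).
    apply is_derive_scal, (is_derive_minus (fun t => F (t + h k)) F).
    - apply is_derive_Reals. rewrite <- (Rmult_1_r (g (t + h k))).
      apply (derivable_pt_lim_comp (fun t => t + h k) F); auto.
    - apply is_derive_Reals, HF. }
  exists xik, dxik, (fun k => 2 * M / h k). repeat split.
  - intros t. apply HD.
  - intros t. unfold dxik, Rdiv.
    apply (continuity_pt_mult (fun t => g (t + h k) - g t) (fun _ => / h k));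
      [|apply continuity_pt_const; now intros ? ?].
    apply (continuity_pt_minus (fun t => g (t + h k)) g); [|apply Hg].
    apply (continuity_pt_comp (fun t => t + h k) g); [|apply Hg].
    apply derivable_continuous_pt. exists 1. apply Hsh.
  - intros k s t [Hst|<-].
    + destruct (MVT_cor2 (xik k) (dxik k) s t Hst) as (c & -> & _); [intros; apply HD|].
      rewrite Rabs_mult, (Rabs_pos_eq (t - s)) by lra.
      apply Rmult_le_compat_r; [lra|]. unfold dxik.
      rewrite Rabs_div, (Rabs_pos_eq (h k)) by (generalize (Hh k); lra).
      apply Rmult_le_compat_r; [apply Rlt_le, Rinv_0_lt_compat, Hh|].
      unfold Rminus. replace (2 * M) with (M + M) by ring.
      apply Rabs_add_le; rewrite ?Rabs_Ropp; auto.
    + rewrite !Rminus_diag, Rabs_R0. lra.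
  - intros eps He.
    (* The interval reaches [T + 1] because the averages look ahead by [h k <= 1]. *)
    destruct (@Heine_cor2 g 0 (T + 1) (fun t _ => Hg t) (mkposreal eps He)) as [d Hd].
    destruct (archimed_cor1 d (cond_pos d)) as (N & HN & HN0).
    exists N. intros k t Hk Ht.
    assert (Hkd : h k < d).
    { apply Rle_lt_trans with (2 := HN), Rinv_le_contravar; [now apply lt_0_INR|].
      apply le_INR; lia. }
    assert (Hk1 : h k <= 1).
    { rewrite <- Rinv_1. apply Rinv_le_contravar; [lra|]. rewrite S_INR.
      generalize (pos_INR k). lra. }
    assert (Hk0 := Hh k).
    destruct (MVT_cor2 F g t (t + h k)) as (c & Ec & Hc); [lra|intros; apply HF|].
    unfold xik. rewrite Ec, <- (Hext t Ht).
    replace (g c * (t + h k - t) / h k) with (g c) by (field; lra).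
    apply Hd; simpl; try lra. rewrite Rabs_pos_eq; lra.
Qed.

(** * Passage to the limit and conclusion *)

Lemma partition_between T n tt j : is_partition T n tt -> (j <= n)%nat -> 0 <= tt j <= T.
Proof.
  intros (_ & H0 & HT & Hs) Hj. split.
  - induction j as [|j IH]; [lra|]. apply Rle_trans with (tt j); [apply IH; lia|apply Hs; lia].
  (* The last index becomes an arbitrary one at most [n], so that induction leaves the hypotheses on
     [n] intact. *)
  - rewrite <- HT. revert Hj. generalize (Nat.le_refl n). generalize n at 1 3 4.
    induction n0 as [|i IH]; intros Hi Hj; [replace j with 0%nat by lia; lra|].
    destruct (Nat.eq_dec j (S i)) as [->|Hne]; [lra|].
    apply Rle_trans with (tt i); [apply IH; lia|apply Hs; lia].
Qed.

Lemma var_sum_close T n tt xi xi' e : is_partition T n tt ->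
  (forall t, 0 <= t <= T -> Rabs (xi' t - xi t) <= e) ->
  var_sum xi n tt <= var_sum xi' n tt + INR n * (2 * e).
Proof.
  intros Hp He.
  assert (Hj : forall j, (j < n)%nat -> Rabs (xi (tt (S j)) - xi (tt j)) <=
    Rabs (xi' (tt (S j)) - xi' (tt j)) + 2 * e).
  { intros j Hj.
    assert (H1 := He _ (partition_between T n tt j Hp ltac:(lia))).
    assert (H2 := He _ (partition_between T n tt (S j) Hp ltac:(lia))).
    apply Rabs_le_between in H1, H2. unfold Rabs. repeat destruct (Rcase_abs _); lra. }
  destruct Hp as (Hn & _). destruct n as [|n]; [lia|].
  unfold var_sum. rewrite Nat.sub_succ, Nat.sub_0_r, Rmult_comm, <- sum_cte, <- sum_plus.
  apply sum_Rle. intros j Hjn. apply Hj. lia.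
Qed.

Lemma unif_cont2_gap Theta : unif_cont2 Theta -> unif_cont2 (fun x y => Rabs (x - y) + Theta x y).
Proof.
  intros H eps He. destruct (H (eps / 3)) as (d & Hd & HT); [lra|].
  exists (Rmin d (eps / 3)). split; [apply Rmin_pos; lra|].
  intros x y a b Ha Hb.
  assert (M1 := Rmin_l d (eps / 3)). assert (M2 := Rmin_r d (eps / 3)).
  specialize (HT x y a b ltac:(lra) ltac:(lra)).
  apply Rabs_def2 in HT.
  assert (Ha' : Rabs (a - x) < eps / 3) by lra. assert (Hb' : Rabs (b - y) < eps / 3) by lra.
  apply Rabs_def2 in Ha', Hb'.
  apply Rabs_def1; unfold Rabs; repeat destruct (Rcase_abs _); lra.
Qed.

Lemma LS_sol_lower_bound T Rr xi Theta u v :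
  0 < T -> cont_path T xi -> unif_cont2 Theta ->
  (forall x y, 0 <= Theta x y) -> (forall x y, Rmin x y >= Rr -> Theta x y >= 1) ->
  LS_sol T xi (fun x y => Rabs (x - y) + Theta x y) u ->
  avg_set T Rr xi v -> Rmin (Rmax v 0) 1 <= u T 0 0.
Proof.
  intros HT Hxi HTh Hpos Hone Hu (n & tt & Hp & ->).
  set (f := fun x y => Rabs (x - y) + Theta x y) in *.
  assert (Hf : unif_cont2 f) by now apply unif_cont2_gap.
  destruct (C1_lipschitz_approximation T xi HT Hxi) as (xik & dxik & Ck & HC1 & HL & Hcv).
  assert (Hvisc : forall k, visc_sol T (dxik k) f (value (Ck k) (xik k) f)).
  { intros k. apply value_visc_sol; auto. apply HC1. }
  apply le_epsilon. intros eps He.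
  (* The game values are taken as the approximating solutions; radius 0 suffices at the origin. *)
  destruct (Hu xik dxik _ HC1 Hcv Hvisc 0 (eps / 2)) as [N1 H1]; [lra|].
  (* Each of the [n] increments changes by at most [2 * (eps / 4)], hence the average by at most
     [eps / 2], whatever [n] is. *)
  destruct (Hcv (eps / 4)) as [N2 H2]; [lra|].
  set (k := max N1 N2).
  specialize (H1 k T 0 0 ltac:(lia)). rewrite Rabs_R0 in H1.
  specialize (H1 ltac:(lra) ltac:(lra) ltac:(lra)). apply Rabs_def2 in H1.
  assert (HV := var_sum_close T n tt xi (xik k) (eps / 4) Hp
    (fun t Ht => Rlt_le _ _ (H2 k t ltac:(lia) Ht))).
  assert (LB := value_lower_bound (Ck k) (xik k) f T Rr n tt (HL k) Hf HT).
  assert (LB' : Rmin (Rmax (var_sum (xik k) n tt / INR n - Rr / INR n) 0) 1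
    <= value (Ck k) (xik k) f T 0 0).
  { apply LB; auto; intros x y.
    - unfold f. generalize (Hpos x y). lra.
    - intros Hx Hy. unfold f.
      assert (Hm : Rmin x y >= Rr) by (apply Rle_ge, Rmin_glb; auto).
      generalize (Hone x y Hm) (Rabs_pos (x - y)). lra. }
  assert (HN : 0 < INR n) by (apply lt_0_INR; destruct Hp; lia).
  assert (HV' : var_sum xi n tt / INR n <= var_sum (xik k) n tt / INR n + eps / 2).
  { apply Rmult_le_reg_r with (INR n); auto.
    replace (var_sum xi n tt / INR n * INR n) with (var_sum xi n tt) by (field; lra).
    replace ((var_sum (xik k) n tt / INR n + eps / 2) * INR n) with
      (var_sum (xik k) n tt + INR n * (2 * (eps / 4))) by (field; lra). exact HV. }
  revert LB'. unfold Rmin, Rmax. repeat destruct (Rle_dec _ _); lra.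
Qed.

Theorem theorem1 (T Rr : R) (xi : R -> R) (Theta : R -> R -> R) (u : R -> R -> R -> R) :
  0 < T -> 0 <= Rr ->
  cont_path T xi ->
  unif_cont2 Theta ->
  (forall x y, 0 <= Theta x y) ->
  (forall x y, Rmin x y >= Rr -> Theta x y >= 1) ->
  LS_sol T xi (fun x y => Rabs (x - y) + Theta x y) u ->
  (forall s, is_lub (avg_set T Rr xi) s -> u T 0 0 >= Rmin (Rmax s 0) 1) /\
  (~ is_upper_bound (tv_set T xi) Rr -> u T 0 0 > 0).
Proof.
  intros HT _ Hxi HTh Hpos Hone Hu.
  assert (LB : forall v, avg_set T Rr xi v -> Rmin (Rmax v 0) 1 <= u T 0 0)
    by (intros v; now apply LS_sol_lower_bound with (Theta := Theta)).
  split.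
  - intros s [_ Hs]. apply Rle_ge, Rnot_lt_le. intros Hlt.
    (* The one-interval partition yields [0 <= u T 0 0], which settles the case where the positive
       part of [s] is 0. *)
    assert (Hone_part : avg_set T Rr xi (var_sum xi 1 (fun j => INR j * T) / INR 1 - Rr / INR 1)).
    { exists 1%nat, (fun j => INR j * T). split; auto.
      split; [lia|]. simpl. repeat split; try lra.
      intros j Hj. replace j with 0%nat by lia. simpl. lra. }
    assert (H0 := LB _ Hone_part).
    (* By [Hlt], [u T 0 0 < 1], so the truncation at 1 is inactive in each bound [LB]. *)
    assert (Hs' : s <= u T 0 0).
    { apply Hs. intros v Hv. specialize (LB v Hv).
      revert LB Hlt. unfold Rmin, Rmax. repeat destruct (Rle_dec _ _); lra. }
    revert H0 Hlt. unfold Rmin, Rmax. repeat destruct (Rle_dec _ _); lra.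
  (* Contrapositive: if [u T 0 0 <= 0], every average is nonpositive, so every variation sum is at
     most [Rr]. *)
  - intros Hub. apply Rnot_le_lt. intros Hle. apply Hub. intros w (n & tt & Hp & ->).
    assert (HN : 0 < INR n) by (apply lt_0_INR; destruct Hp; lia).
    assert (H := LB _ (ex_intro _ n (ex_intro _ tt (conj Hp eq_refl)))).
    assert (Hv : var_sum xi n tt / INR n - Rr / INR n <= 0)
      by (revert H; unfold Rmin, Rmax; repeat destruct (Rle_dec _ _); lra).
    apply Rmult_le_compat_r with (r := INR n) in Hv; [|lra].
    replace ((var_sum xi n tt / INR n - Rr / INR n) * INR n) with (var_sum xi n tt - Rr) in Hv
      by (field; lra).
    lra.
Qed.
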